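(* Let $\tau,t\in\mathbb{R}$ and let $\beta_n=\beta_n(\tau,t)$, $n\ge1$, be the recurrence coefficients of the monic orthogonal polynomials for the weight $\omega(x;\tau,t)=\exp(-x^6+\tau x^4+tx^2)$ on $\mathbb{R}$. For each sufficiently large $n$, let $\beta(n)$ denote the unique real root of the cubic $$60\beta^3-12\tau\beta^2-2t\beta=n,$$ which is positive. Then $\displaystyle\lim_{n\to\infty}\frac{\beta_n}{\beta(n)}=1$.
   Context: The monic polynomials $P_n(x)$ of exact degree $n$ satisfy $\int_{-\infty}^{\infty}P_m(x)P_n(x)\,\omega(x;\tau,t)\,dx=h_n\delta_{mn}$ with $h_n>0$. Since the weight is even, they satisfy the three-term recurrence $P_{n+1}(x)=xP_n(x)-\beta_nP_{n-1}(x)$ with $P_{-1}=0$, $P_0=1$, and $\beta_n=h_n/h_{n-1}>0$ for $n\ge1$. *)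

(* Defs.v *)
From HB Require Import structures.
From mathcomp Require Import all_boot all_order all_algebra.
From mathcomp Require Import all_classical all_reals all_analysis.
Set Implicit Arguments. Unset Strict Implicit. Unset Printing Implicit Defensive.
Import Order.TTheory GRing.Theory Num.Theory.
Import numFieldNormedType.Exports.
Local Open Scope classical_set_scope.
Local Open Scope ring_scope.

Definition weight {R : realType} (tau t : R) (x : R) : R :=
  expR (- x ^+ 6 + tau * x ^+ 4 + t * x ^+ 2).

Definition monic_OPS {R : realType} (tau t : R)
    (P : nat -> {poly R}) (h : nat -> R) : Prop :=
  (forall n, P n \is monic /\ size (P n) = n.+1) /\
  (forall m n, (@lebesgue_measure R).-integrable setT
      (fun x => ((P m).[x] * (P n).[x] * weight tau t x)%:E)) /\
  (forall m n, (\int[@lebesgue_measure R]_(x in setT)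
      ((P m).[x] * (P n).[x] * weight tau t x)%:E)%E
      = (if m == n then h n else 0)%:E) /\
  (forall n, 0 < h n).

(* recurrence coefficient beta_n = h_n / h_{n-1}, n >= 1 *)
Definition rec_coef {R : realType} (h : nat -> R) (n : nat) : R := h n / h n.-1.

Definition cubic {R : realType} (tau t b : R) : R :=
  60 * b ^+ 3 - 12 * tau * b ^+ 2 - 2 * t * b.

(* Main.v *)
Require Import Defs.
From HB Require Import structures.
From mathcomp Require Import all_boot all_order all_algebra.
From mathcomp Require Import all_classical all_reals all_analysis.
From mathcomp Require Import measurable_realfun ring lra.
Set Implicit Arguments.
Unset Strict Implicit.
Unset Printing Implicit Defensive.
Import Order.TTheory GRing.Theory Num.Theory.
Import numFieldNormedType.Exports.
Local Open Scope classical_set_scope.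
Local Open Scope ring_scope.

(** Let [L p] be the integral of [p] against the weight [exp (- V)].
    Integrating [(P_n P_(n-1) exp (- V))'] over the line gives
    [n h_(n-1) = L (P_n P_(n-1) V')], and the three-term recurrence turns this
    into the string equation
    [n = beta_n (6 Q_n - 4 tau (beta_(n-1) + beta_n + beta_(n+1)) - 2 t)],
    where [Q_n] is a sum of ten products of two of the coefficients
    [beta_(n-2), ..., beta_(n+2)].  Positivity forces
    [beta_n = O(n^(1/3))], so for [z_n = beta_n / n^(1/3)], with limsup [A] and
    liminf [a], evaluating the equation where [z_n] is close to [A], and then
    to [a], gives
    [A (A^2 + 4 a A + 5 a^2) <= 1/6 <= a (a^2 + 4 a A + 5 A^2)].
    The outer terms differ by [(A - a) (A^2 + a^2)], hence [A = a] and
    [60 A^3 = 1]; the root of the cubic, divided by [n^(1/3)], has the same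
    limit. *)

(** * Integration against the weight *)

(** Dominated convergence: [|f|] majorizes the restrictions of [f] to [D n], extended by zero. *)
Lemma cvg_integral_exhaustion (d : measure_display) (T : measurableType d)
    (R : realType) (mu : {measure set T -> \bar R})
    (D : nat -> set T) (f : T -> R) :
  (forall n, measurable (D n)) -> (forall x, \forall n \near \oo, D n x) ->
  mu.-integrable setT (EFin \o f) ->
  \int[mu]_(x in D n) f x @[n --> \oo] --> \int[mu]_x f x.
Proof.
move=> mD cover fi; have mf := measurable_int _ fi.
pose F : nat -> T -> \bar R := fun n => (EFin \o f) \_ (D n).
have mF n : measurable_fun setT (F n).
  by apply/(measurable_restrictT _ _).1 => //; exact: measurable_funTS.
have FfE : {ae mu, forall x, setT x -> F ^~ x @ \oo --> (EFin \o f) x}.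
  apply: aeW => x _; apply: cvg_near_cst; apply: filterS (cover x) => n Dnx.
  by rewrite /F patchE ifT// inE.
have Fle : {ae mu, forall x n, setT x ->
    (`|F n x| <= (abse \o (EFin \o f)) x)%E}.
  by apply: aeW => x n _; rewrite /F patchE; case: ifPn;
    rewrite ?abse0 ?abse_ge0.
have [_ _] := dominated_convergence measurableT mF mf FfE
  (integrable_abse fi) Fle.
rewrite /Rintegral -[X in _ --> X -> _]fineK ?integrable_fin_num//.
move=> /fine_cvg; apply: cvg_trans.
apply: near_eq_cvg; near=> n => /=.
by rewrite [in RHS]integral_mkcond.
Unshelve. all: by end_near. Qed.

Section symmetric_intervals.
Context {R : realType}.
Local Notation mu := (@lebesgue_measure R).

(** Reduces integrals over the line to compact intervals, where reflection and the fundamental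
    theorem of calculus apply. *)
Lemma cvg_integral_symmetric_itv (f : R -> R) :
  mu.-integrable setT (EFin \o f) ->
  \int[mu]_(x in `[- n%:R, n%:R]) f x @[n --> \oo] --> \int[mu]_x f x.
Proof.
apply: cvg_integral_exhaustion => // x; near=> n.
by rewrite /= in_itv/= -ler_norml; near: n; exact: nbhs_infty_ger.
Unshelve. all: by end_near. Qed.

Lemma integral_opp_itv (f : R -> R) (a : R) : 0 <= a -> continuous f ->
  \int[mu]_(x in `[- a, a]) f x = \int[mu]_(x in `[- a, a]) f (- x).
Proof.
move=> a0 cf; rewrite /Rintegral; congr fine.
rewrite -{2}[a]opprK integration_by_substitution_oppr//; first by lra.
exact: continuous_subspaceT.
Qed.

Lemma integral_derive_itv (F f : R -> R) (a : R) : 0 < a -> continuous f ->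
  (forall x : R, is_derive x (1 : R) F (f x)) ->
  \int[mu]_(x in `[- a, a]) f x = F a - F (- a).
Proof.
move=> a0 cf dF; rewrite /Rintegral.
have dF1 x : derivable F x 1 by case: (dF x).
have cF : continuous F.
  by move=> x; apply/differentiable_continuous/derivable1_diffP.
rewrite (@continuous_FTC2 _ f F)//; first by lra.
- exact: continuous_subspaceT.
- split; first by move=> x _.
  + by apply: cvg_at_right_filter; exact: cF.
  + by apply: cvg_at_left_filter; exact: cF.
- by move=> x _; rewrite derive1E; case: (dF x).
Qed.
End symmetric_intervals.

(** * Decay, symmetry and integration by parts for the weight *)

Section weight.
Context {R : realType} (tau t : R).
Local Notation mu := (@lebesgue_measure R).
Local Notation w := (weight tau t).

Definition potential_deriv : {poly R} :=
  6 *: 'X^5 - (4 * tau) *: 'X^3 - (2 * t) *: 'X.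

(** The exponent [- V] itself, whence the sign in [pot_deriv]. *)
Let pot : {poly R} := - 'X^6 + tau *: 'X^4 + t *: 'X^2.

Let weightE x : w x = expR pot.[x].
Proof. by rewrite /weight /pot !hornerE. Qed.

Let pot_deriv : pot^`() = - potential_deriv.
Proof.
rewrite /pot /potential_deriv !(derivD, derivN, derivZ, derivXn) /=.
by rewrite -!mul_polyC !polyCM ?polyC_natr; ring.
Qed.

Lemma is_derive_poly_weight (p : {poly R}) (x : R) :
  is_derive x (1 : R) (fun x => p.[x] * w x)
    ((p^`() - p * potential_deriv).[x] * w x).
Proof.
have -> : (fun x => p.[x] * w x) = (horner p * (expR \o horner pot))%R.
  by apply/funext => y; rewrite weightE.
have De : is_derive x (1 : R) (expR \o horner pot) (expR pot.[x] * pot^`().[x]).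
  exact: is_derive1_comp.
apply: (trigger_derive (is_deriveM (is_derive_poly p x) De)).
rewrite /GRing.scale/= pot_deriv weightE !hornerE /=.
ring.
Qed.

Lemma continuous_poly_weight (p : {poly R}) : continuous (fun x => p.[x] * w x).
Proof.
move=> x; apply/differentiable_continuous/derivable1_diffP.
by case: (is_derive_poly_weight p x).
Qed.

(** For large [n] the weight is at most [exp (- n)], and [exp n >= n^(k+1) / (k+1)!] leaves the
    bound [(k+1)! / n]. *)
Lemma cvg_exprn_weight (k : nat) : (n%:R ^+ k * w n%:R : R) @[n --> \oo] --> 0.
Proof.
have cV : (k.+1`!%:R / n%:R : R) @[n --> \oo] --> 0.
  rewrite -[X in _ --> X](mulr0 (k.+1`!%:R : R)); apply: cvgM.
    exact: cvg_cst.
  apply/gtr0_cvgV0; last exact: cvgr_idn.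
  by near=> n; rewrite ltr0n; near: n; exact: nbhs_infty_gt.
apply: squeeze_cvgr (cvg_cst 0) cV; near=> n.
have nM : 1 + `|tau| + `|t| <= n%:R :> R by near: n; exact: nbhs_infty_ger.
set x := n%:R : R in nM *.
have [tau0 t0] : tau <= `|tau| /\ t <= `|t| by split; exact: ler_norm.
have [tau1 t1] : 0 <= `|tau| /\ 0 <= `|t| by [].
have x1 : 1 <= x by lra.
have x0 : 0 < x by lra.
have w0 : 0 < w x by exact: expR_gt0.
rewrite mulr_ge0 ?exprn_ge0 ?(ltW w0) ?(ltW x0)//=.
have wx : w x <= expR (- x).
  rewrite ler_expR.
  (* By the choice of [x], [x^6 >= x^5 + |tau| x^5 + |t| x^5], and these terms dominate [x],
     [tau x^4] and [t x^2]. *)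
  have : 0 <= (x - (1 + `|tau| + `|t|)) * x ^+ 5.
    by rewrite mulr_ge0 ?subr_ge0 ?exprn_ge0// ltW.
  have p1 m : 1 <= x ^+ m by exact: exprn_ege1.
  have : 0 <= (x ^+ 4 - 1) * x by rewrite mulr_ge0 ?subr_ge0 ?p1// ltW.
  have : 0 <= `|tau| * (x ^+ 4 * (x - 1)).
    by rewrite !mulr_ge0 ?subr_ge0 ?exprn_ge0// ltW.
  have : 0 <= (`|tau| - tau) * x ^+ 4.
    by rewrite mulr_ge0 ?subr_ge0 ?exprn_ge0// ltW.
  have : 0 <= `|t| * (x ^+ 2 * (x ^+ 3 - 1)).
    by rewrite !mulr_ge0 ?subr_ge0 ?exprn_ge0// ltW.
  have : 0 <= (`|t| - t) * x ^+ 2.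
    by rewrite mulr_ge0 ?subr_ge0 ?exprn_ge0// ltW.
  lra.
apply: (@le_trans _ _ (x ^+ k * expR (- x))).
  by rewrite ler_wpM2l ?exprn_ge0// ltW.
rewrite expRN ler_pdivrMr ?expR_gt0// mulrAC ler_pdivlMr// -exprSr.
have := expR_ge1Dxn k (ltW x0).
have f0 : 0 < k.+1`!%:R :> R by rewrite ltr0n fact_gt0.
move=> H; rewrite mulrC -ler_pdivrMr//; apply: le_trans H; lra.
Unshelve. all: by end_near. Qed.

Lemma cvg_poly_weight (p : {poly R}) : p.[n%:R] * w n%:R @[n --> \oo] --> 0.
Proof.
(* The extra power of [n] absorbs the multiplication by ['X] in the Horner induction. *)
suff H k : (p.[n%:R] * (n%:R ^+ k * w n%:R)) @[n --> \oo] --> 0.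
  by have := H 0%N; under eq_fun do rewrite expr0 mul1r.
elim/poly_ind: p k => [|p c IH] k.
  by under eq_fun do rewrite horner0 mul0r; exact: cvg_cst.
under eq_fun do rewrite hornerMXaddC mulrDl -mulrA [_%:R * (_ * _)]mulrA -exprS.
have := cvgD (IH k.+1) (cvgM (cvg_cst c) (cvg_exprn_weight k)).
by rewrite mulr0 addr0; exact.
Qed.

Let weight_even x : w (- x) = w x.
Proof. by rewrite /weight; congr expR; ring. Qed.

Hypothesis wi : forall p : {poly R},
  mu.-integrable setT (fun x => (p.[x] * w x)%:E).

Lemma integral_poly_weight_even (p : {poly R}) :
  \int[mu]_x ((p \Po (- 'X)).[x] * w x) = \int[mu]_x (p.[x] * w x).
Proof.
have c1 := cvg_integral_symmetric_itv (wi p).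
have c2 := cvg_integral_symmetric_itv (wi (p \Po (- 'X))).
apply: cvg_unique c2 _ => //; apply: cvg_trans c1; apply: near_eq_cvg.
near=> n; rewrite integral_opp_itv ?ler0n//; last exact: continuous_poly_weight.
by apply: eq_Rintegral => x _; rewrite horner_comp !hornerE weight_even.
Unshelve. all: by end_near. Qed.

(** The difference of the integrands is the derivative of [p w], so over [[-n, n]] only boundary
    terms remain, and they vanish in the limit. *)
Lemma integral_poly_weight_deriv (p : {poly R}) :
  \int[mu]_x (p^`().[x] * w x) = \int[mu]_x ((p * potential_deriv).[x] * w x).
Proof.
apply/eqP; rewrite -subr_eq0; apply/eqP.
rewrite -RintegralB//; [|exact: wi..].
transitivity (\int[mu]_x ((p^`() - p * potential_deriv).[x] * w x)).
  by apply: eq_Rintegral => x _; rewrite -mulrBl -hornerN -hornerD.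
have c1 := cvg_integral_symmetric_itv (wi (p^`() - p * potential_deriv)).
apply: cvg_unique c1 _ => //.
(* By evenness of the weight the boundary term at [-n] is one at [n] for the reflected polynomial,
   so decay along the positive integers suffices. *)
have cN : p.[n%:R] * w n%:R - (p \Po (- 'X)).[n%:R] * w n%:R @[n --> \oo] --> 0.
  by rewrite -[X in _ --> X](subrr 0); apply: cvgB; exact: cvg_poly_weight.
apply: cvg_trans cN; apply: near_eq_cvg; near=> n.
rewrite (integral_derive_itv _ _ (is_derive_poly_weight p)).
- by rewrite weight_even horner_comp !hornerE.
- by rewrite ltr0n; near: n; exact: nbhs_infty_gt.
- exact: continuous_poly_weight.
Unshelve. all: by end_near. Qed.

End weight.

(** * Recurrence and string equation *)

Lemma size_sub_monic (R : nzRingType) (n : nat) (p q : {poly R}) :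
  q \is monic -> size q = n.+1 -> (size p <= n.+1)%N ->
  (size (p - p`_n *: q)%R <= n)%N.
Proof.
move=> /monicP mq sq sp; apply/leq_sizeP => j nj; rewrite coefB coefZ.
move: nj; rewrite leq_eqVlt => /predU1P[<-|nj].
  by move: mq; rewrite lead_coefE sq /= => ->; rewrite mulr1 subrr.
rewrite (nth_default _ (leq_trans sp nj)).
by rewrite [q`_j]nth_default ?sq// mulr0 subrr.
Qed.

Section orthogonal_polynomials.
Variables (R : realFieldType) (P : nat -> {poly R}).
Hypothesis P_monic : forall n, P n \is monic.
Hypothesis P_size : forall n, size (P n) = n.+1.

(** The [P i] with [i < n] span the polynomials of degree below [n]. As an induction principle this
    serves both the vanishing of [L] and the integrability against the weight. *)
Lemma monic_basis_ind (n : nat) (K : {poly R} -> Prop) :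
  K 0 ->
  (forall a i q, (i < n)%N -> K q -> K (a *: P i + q)) ->
  forall p : {poly R}, (size p <= n)%N -> K p.
Proof.
move=> K0; elim: n => [|n IH] KS p.
  by rewrite leqn0 size_poly_eq0 => /eqP->.
move=> sp; rewrite -[p](subrK (p`_n *: P n)) addrC; apply: (KS) => //.
by apply: IH; [move=> a i q lin; apply: KS; exact: ltnW|exact: size_sub_monic].
Qed.

Variables (L : {poly R} -> R) (h : nat -> R).
Hypothesis LD : forall p q : {poly R}, L (p + q) = L p + L q.
Hypothesis LZ : forall (a : R) (p : {poly R}), L (a *: p) = a * L p.
Hypothesis LP : forall m n, L (P m * P n) = if m == n then h n else 0.
Hypothesis h_gt0 : forall n, 0 < h n.

Let L0 : L 0 = 0.
Proof. by rewrite -(scale0r 0) LZ mul0r. Qed.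

Let LB (p q : {poly R}) : L (p - q) = L p - L q.
Proof. by rewrite LD -scaleN1r LZ mulN1r. Qed.

Let h_neq0 n : h n != 0.
Proof. by rewrite gt_eqF. Qed.

Lemma orthogonal_lower (n : nat) (q : {poly R}) :
  (size q <= n)%N -> L (P n * q) = 0.
Proof.
move: q; apply: monic_basis_ind => [|a i q lin IH]; first by rewrite mulr0.
by rewrite mulrDr LD IH -scalerAr LZ LP gtn_eqF// mulr0 addr0.
Qed.

Lemma orthogonal_top (n : nat) (q : {poly R}) :
  (size q <= n.+1)%N -> L (P n * q) = q`_n * h n.
Proof.
move=> sq; rewrite -[in LHS](subrK (q`_n *: P n) q) mulrDr LD.
rewrite orthogonal_lower ?add0r; last exact: size_sub_monic.
by rewrite -scalerAr LZ LP eqxx.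
Qed.

(** A nonzero [p] of degree [d < n] would give [L (P d * p) = lead_coef p * h d], which is not
    zero. *)
Lemma orthogonal_eq0 (n : nat) (p : {poly R}) : (size p <= n)%N ->
  (forall m, (m < n)%N -> L (P m * p) = 0) -> p = 0.
Proof.
move=> sp Lp; apply/eqP; apply: contraT => p0.
have sp0 : (0 < size p)%N by rewrite size_poly_gt0.
have := Lp (size p).-1; rewrite prednK// => /(_ sp).
rewrite orthogonal_top ?prednK// => /eqP; rewrite mulf_eq0 (negbTE (h_neq0 _)).
by rewrite orbF -lead_coefE lead_coef_eq0 (negbTE p0).
Qed.

Hypothesis L_even : forall p, L (p \Po (- 'X)) = L p.

Let size_compNX (p : {poly R}) : size (p \Po (- 'X)) = size p.
Proof. by rewrite size_comp_poly2// size_polyN size_polyX. Qed.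

Let compNXK (p : {poly R}) : (p \Po (- 'X)) \Po (- 'X) = p.
Proof. by rewrite -comp_polyA rmorphN /= comp_polyX opprK comp_polyXr. Qed.

Let coef_compNX (p : {poly R}) i : (p \Po (- 'X))`_i = (-1) ^+ i * p`_i.
Proof.
rewrite -scaleN1r; elim/poly_ind: p i => [|p c IH] i.
  by rewrite comp_poly0 !coef0 mulr0.
rewrite comp_polyD comp_polyC comp_polyM comp_polyX.
rewrite -scalerAr !coefD coefZ !coefMX.
rewrite !coefC; case: i => [|i] /=; first by rewrite mulr0 expr0 mul1r.
by rewrite IH exprS !addr0 mulrA.
Qed.

(** The difference of the two sides has degree below [n] and, as [L] is even, is orthogonal to every
    [P m] with [m < n]. *)
Lemma orthogonal_parity (n : nat) : P n \Po (- 'X) = (-1) ^+ n *: P n.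
Proof.
have cn : (P n)`_n = 1.
  by move/monicP: (P_monic n); rewrite lead_coefE P_size.
apply/eqP; rewrite -subr_eq0; apply/eqP.
(* Writing the sign as the top coefficient puts the difference in the form of [size_sub_monic]. *)
have -> : (-1) ^+ n = (P n \Po (- 'X))`_n by rewrite coef_compNX cn mulr1.
apply: (@orthogonal_eq0 n).
  by apply: size_sub_monic => //; rewrite size_compNX P_size.
move=> m mn; rewrite mulrBr LB -scalerAr LZ LP ltn_eqF// mulr0 subr0.
rewrite -L_even comp_polyM compNXK mulrC; apply: orthogonal_lower.
by rewrite size_compNX P_size.
Qed.

(** Since [0.-1 = 0], [beta 0] is [1] and not the customary [0]; the recurrence and the string
    equation below start high enough to involve positive indices only. *)
Let beta (n : nat) := h n / h n.-1.

(** The difference of the two sides has degree at most [n + 1]. It is orthogonal to [P m] for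
    [m = n + 1] by parity, for [m = n] by the choice of [beta], and for [m < n] by degree. *)
Lemma three_term_recurrence (n : nat) :
  'X * P n.+1 = P n.+2 + beta n.+1 *: P n.
Proof.
(* ['X * P k ^+ 2] is odd, so [L] of it equals its own opposite. *)
have LXP k : L (P k * ('X * P k)) = 0.
  have : L (P k * ('X * P k)) = - L (P k * ('X * P k)).
    rewrite -{1}L_even !comp_polyM comp_polyX orthogonal_parity.
    rewrite -scalerAl LZ -!scalerAr LZ mulrA -expr2 -exprM mulnC exprM.
    by rewrite sqrrN expr1n expr1n mul1r mulNr mulrN -scaleN1r LZ mulN1r.
  lra.
have sX (q : {poly R}) : (size ('X * q)%R <= (size q).+1)%N.
  by apply: leq_trans (size_polyMleq _ _) _; rewrite size_polyX.
have cX k : ('X * P k)`_k.+1 = 1.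
  by rewrite coefXM /=; move/monicP: (P_monic k); rewrite lead_coefE P_size.
apply/eqP; rewrite -subr_eq0 opprD addrA; apply/eqP.
apply: (@orthogonal_eq0 n.+2).
  apply: leq_trans (size_polyD _ _) _; rewrite geq_max; apply/andP; split.
    rewrite -[P n.+2]scale1r -(cX n.+1); apply: size_sub_monic => //.
    by rewrite (leq_trans (sX _))// P_size.
  by rewrite size_polyN (leq_trans (size_scale_leq _ _))// P_size.
move=> m mn; rewrite !mulrBr !LB -scalerAr LZ !LP (ltn_eqF mn) subr0.
move: mn; rewrite ltnS leq_eqVlt => /predU1P[->|].
  by rewrite LXP gtn_eqF// mulr0 subrr.
rewrite ltnS => mn.
(* With ['X] moved to the factor of lower degree, only the coefficient of index [n + 1] of
   ['X * P m] counts. *)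
have -> : P m * ('X * P n.+1) = P n.+1 * ('X * P m) by ring.
rewrite orthogonal_top; last first.
  by rewrite (leq_trans (sX _))// P_size.
move: mn; rewrite leq_eqVlt => /predU1P[->|mn].
  by rewrite cX eqxx mul1r /beta /= divfK// subrr.
rewrite ltn_eqF// mulr0 subr0 nth_default ?mul0r//.
by rewrite (leq_trans (sX _))// P_size.
Qed.

Variables tau t : R.
Hypothesis L_deriv : forall p : {poly R},
  L p^`() = L (p * (6 *: 'X^5 - (4 * tau) *: 'X^3 - (2 * t) *: 'X)).

(** Both sides, multiplied by [h n.+2], are values of [L] at the derivative of [P n.+3 * P n.+2]:
    one by degrees, the other by [L_deriv] and the recurrence. *)
Lemma string_equation (n : nat) :
  let b1 := beta n.+1 in let b2 := beta n.+2 in let b3 := beta n.+3 in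
  let b4 := beta n.+4 in let b5 := beta n.+4.+1 in
  n.+3%:R = b3 * (6 * (b1 * b2 + b2 ^+ 2 + 2 * b2 * b3 + b3 ^+ 2 + b2 * b4 +
    2 * b3 * b4 + b4 ^+ 2 + b4 * b5) - 4 * tau * (b2 + b3 + b4) - 2 * t).
Proof.
move=> b1 b2 b3 b4 b5.
(* The index comparisons that remain after [eqSS] strips common successors. *)
have [ne2 ne2' ne4 ne4' ne6] : [/\ (n.+2 == n) = false, (n == n.+2) = false,
    (n.+4 == n) = false, (n == n.+4) = false & (n.+4.+2 == n) = false].
  by split; elim: (n).
have X1 : 'X * P n.+1 = P n.+2 + b1 *: P n by exact: three_term_recurrence.
have X2 : 'X * P n.+2 = P n.+3 + b2 *: P n.+1 by exact: three_term_recurrence.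
have X3 : 'X * P n.+3 = P n.+4 + b3 *: P n.+2 by exact: three_term_recurrence.
have X4 : 'X * P n.+4 = P n.+4.+1 + b4 *: P n.+3
  by exact: three_term_recurrence.
have X5 : 'X * P n.+4.+1 = P n.+4.+2 + b5 *: P n.+4
  by exact: three_term_recurrence.
have h1 : h n.+1 = b1 * h n by rewrite /b1 /beta divfK.
have h2 : h n.+2 = b2 * h n.+1 by rewrite /b2 /beta divfK.
have h3 : h n.+3 = b3 * h n.+2 by rewrite /b3 /beta divfK.
have h4 : h n.+4 = b4 * h n.+3 by rewrite /b4 /beta divfK.
clearbody b1 b2 b3 b4 b5.
have LDl p q r : L ((p + q) * r) = L (p * r) + L (q * r) by rewrite mulrDl LD.
have LDr p q r : L (r * (p + q)) = L (r * p) + L (r * q) by rewrite mulrDr LD.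
have LZl a p q : L (a *: p * q) = a * L (p * q) by rewrite -scalerAl LZ.
have LZr a p q : L (p * (a *: q)) = a * L (p * q) by rewrite -scalerAr LZ.
have LBr p q r : L (r * (p - q)) = L (r * p) - L (r * q) by rewrite mulrBr LB.
have XX2 : 'X * ('X * P n.+2) =
    P n.+4 + (b3 + b2) *: P n.+2 + (b2 * b1) *: P n.
  rewrite X2 mulrDr X3 -scalerAr X1.
  by rewrite -!mul_polyC !(polyCD, polyCM); ring.
have XX3 : 'X * ('X * P n.+3) =
    P n.+4.+1 + (b4 + b3) *: P n.+3 + (b3 * b2) *: P n.+1.
  rewrite X3 mulrDr X4 -scalerAr X2.
  by rewrite -!mul_polyC !(polyCD, polyCM); ring.
have XXX3 : 'X * ('X * ('X * P n.+3)) =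
    P n.+4.+2 + (b5 + b4 + b3) *: P n.+4 + ((b4 + b3) * b3 + b3 * b2) *: P n.+2
    + (b3 * b2 * b1) *: P n.
  rewrite XX3 !mulrDr X5 -!scalerAr X3 X1.
  by rewrite -!mul_polyC !(polyCD, polyCM); ring.
(* Three factors ['X] go to [P n.+3] and two to [P n.+2]; orthogonality then pairs the two short
   expansions term by term. *)
have E5 : L (P n.+3 * P n.+2 * 'X^5) = h n.+2 * (b3 *
    (b1 * b2 + b2 ^+ 2 + 2 * b2 * b3 + b3 ^+ 2 + b2 * b4 +
    2 * b3 * b4 + b4 ^+ 2 + b4 * b5)).
  have -> : P n.+3 * P n.+2 * 'X^5 =
      ('X * ('X * ('X * P n.+3))) * ('X * ('X * P n.+2)) by ring.
  rewrite XXX3 XX2 !(LDl, LDr, LZl, LZr) !LP.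
  rewrite !eqSS ?eqxx ?ne2 ?ne2' ?ne4 ?ne4' ?ne6.
  by rewrite h4 h3 h2 h1; ring.
have E3 : L (P n.+3 * P n.+2 * 'X^3) = h n.+2 * (b3 * (b2 + b3 + b4)).
  have -> : P n.+3 * P n.+2 * 'X^3 =
      ('X * ('X * P n.+3)) * ('X * P n.+2) by ring.
  rewrite XX3 X2 !(LDl, LDr, LZl, LZr) !LP.
  rewrite !eqSS ?eqxx ?ne2 ?ne2' ?ne4 ?ne4' ?ne6.
  by rewrite h3 h2 h1; ring.
have E1 : L (P n.+3 * P n.+2 * 'X) = h n.+2 * b3.
  have -> : P n.+3 * P n.+2 * 'X = ('X * P n.+3) * P n.+2 by ring.
  rewrite X3 !(LDl, LDr, LZl, LZr) !LP.
  rewrite !eqSS ?eqxx ?ne2 ?ne2' ?ne4 ?ne4' ?ne6.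
  by rewrite add0r mulrC.
(* The derivative of [P n.+3] has top coefficient [n + 3] against [P n.+2]; that of [P n.+2] has too
   low a degree to meet [P n.+3]. *)
have D1 : L ((P n.+3 * P n.+2)^`()) = n.+3%:R * h n.+2.
  rewrite derivM LD [_ * P n.+2]mulrC (@orthogonal_top n.+2); last first.
    by rewrite -ltnS -(P_size n.+3) lt_size_deriv// -size_poly_eq0 P_size.
  rewrite coef_deriv; move/monicP: (P_monic n.+3).
  rewrite lead_coefE P_size /= => ->; rewrite orthogonal_lower ?addr0//.
  by rewrite (leq_trans (ltnW (lt_size_deriv _)))// -?size_poly_eq0 P_size.
apply: (mulIf (h_neq0 n.+2)); rewrite -D1 L_deriv.
by rewrite !(LBr, LZr) E5 E3 E1; ring.
Qed.
End orthogonal_polynomials.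

(** * Asymptotics of the string equation *)

Section eventually_nat.
Context {R : realType}.

Lemma near_infty_addn (k : nat) (Q : nat -> Prop) :
  (\forall n \near \oo, Q n) -> \forall n \near \oo, Q (n + k)%N.
Proof.
move=> [N _ QN]; exists N => // n /= Nn; apply: QN.
exact: leq_trans (leq_addr _ _).
Qed.

(** [A] is the infimum of the eventual upper bounds; since [A - e] is not one of them, the sequence
    exceeds it at arbitrarily large indices. *)
Lemma bounded_limsup (z : nat -> R) (M : R) :
  (\forall n \near \oo, 0 <= z n <= M) ->
  exists A : R, [/\ A <= M,
    forall e : R, 0 < e -> \forall n \near \oo, z n <= A + e &
    forall e : R, 0 < e -> forall N, exists2 n, (N <= n)%N & A - e <= z n].
Proof.
move=> [N0 _ zM]; pose S := [set x | \forall n \near \oo, z n <= x].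
have SM : S M by exists N0 => // n /zM /andP[].
have lbS : lbound S 0.
  move=> x [N _ zx]; have /andP[z0 _] := zM _ (leq_maxl N0 N).
  exact: le_trans z0 (zx _ (leq_maxr N0 N)).
have hS : has_inf S by split; [exists M|exists 0].
exists (inf S); split.
- by apply: ge_inf => //; exists 0.
- move=> e e0; have [x Sx xe] := inf_adherent e0 hS.
  by apply: filterS Sx => n zx; apply: le_trans zx (ltW xe).
- move=> e e0 N; apply: contrapT => H.
  have : S (inf S - e).
    exists N => // n /= Nn; rewrite leNgt; apply/negP => zn.
    by apply: H; exists n => //; exact: ltW.
  move/(ge_inf (ex_intro _ 0 lbS)); lra.
Qed.

Lemma bounded_liminf (z : nat -> R) (m M : R) :
  (\forall n \near \oo, m <= z n <= M) ->
  exists a : R, [/\ m <= a,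
    forall e : R, 0 < e -> \forall n \near \oo, a - e <= z n &
    forall e : R, 0 < e -> forall N, exists2 n, (N <= n)%N & z n <= a + e].
Proof.
move=> zM; have [|A [AM Ale Age]] := @bounded_limsup (fun n => M - z n) (M - m).
  by apply: filterS zM => n /andP[? ?]; apply/andP; split; lra.
exists (M - A); split; first by lra.
- by move=> e /Ale; apply: filterS => n; lra.
- by move=> e e0 N; have [n Nn H] := Age e e0 N; exists n => //; lra.
Qed.

End eventually_nat.

(** * The leading form of the string equation *)

Section freud_form.
Context {R : realFieldType}.

(* The ten monomials are the paths with five unit steps from level 3 to level 2,
   each step down from level [i] contributing [vi]. *)
Definition freud_form (v1 v2 v3 v4 v5 : R) : R :=
  v3 * (v1 * v2 + v2 ^+ 2 + 2 * v2 * v3 + v3 ^+ 2 + v2 * v4 +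
        2 * v3 * v4 + v4 ^+ 2 + v4 * v5).

Lemma le_freud_form (u1 u2 u3 u4 u5 v1 v2 v3 v4 v5 : R) :
  0 <= u1 <= v1 -> 0 <= u2 <= v2 -> 0 <= u3 <= v3 -> 0 <= u4 <= v4 ->
  0 <= u5 <= v5 -> freud_form u1 u2 u3 u4 u5 <= freud_form v1 v2 v3 v4 v5.
Proof.
move=> /andP[u1p h1] /andP[u2p h2] /andP[u3p h3] /andP[u4p h4] /andP[u5p h5].
rewrite /freud_form; apply: ler_pM => //.
  by rewrite ?(addr_ge0, mulr_ge0, exprn_ge0).
have M (a b c d : R) : 0 <= a -> a <= b -> 0 <= c -> c <= d -> a * c <= b * d.
  by move=> ? ? ? ?; exact: ler_pM.
have := M _ _ _ _ u1p h1 u2p h2; have := M _ _ _ _ u2p h2 u2p h2.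
have := M _ _ _ _ u2p h2 u3p h3; have := M _ _ _ _ u3p h3 u3p h3.
have := M _ _ _ _ u2p h2 u4p h4; have := M _ _ _ _ u3p h3 u4p h4.
have := M _ _ _ _ u4p h4 u4p h4; have := M _ _ _ _ u4p h4 u5p h5.
rewrite !expr2; lra.
Qed.

(* The difference of the two sides of the hypothesis is
   [(A - a) * (A ^+ 2 + a ^+ 2)] up to [O(e)]. *)
Lemma freud_form_extremal_eq (a A : R) : 0 < a -> a <= A -> A <= 1 ->
  (forall e : R, 0 < e -> e <= 1 ->
    freud_form ((1 - e) * a) ((1 - e) * a) ((1 - e) * A) ((1 - e) * a)
      ((1 - e) * a) <=
    freud_form ((1 + e) * A) ((1 + e) * A) ((1 + e) * a) ((1 + e) * A)
      ((1 + e) * A) + e) -> A = a.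
Proof.
move=> a0 aA A1 H; apply/eqP; rewrite eq_le aA andbT leNgt; apply/negP => ltaA.
pose f x y : R := x * (5 * y ^+ 2 + 4 * x * y + x ^+ 2).
have homf s x y : freud_form (s * y) (s * y) (s * x) (s * y) (s * y) =
    s ^+ 3 * f x y.
  by rewrite /freud_form /f; ring.
have A0 : 0 < A by lra.
(* The bound is the sum [5 + 4 + 1] of the coefficients of [f]. *)
have f10 x y : 0 < x -> x <= 1 -> 0 < y -> y <= 1 -> 0 <= f x y <= 10.
  move=> x0 x1 y0 y1; apply/andP; split.
    by rewrite /f mulr_ge0 ?addr_ge0 ?mulr_ge0 ?exprn_ge0 ?mulr_ge0//; lra.
  have yy : y ^+ 2 <= 1 by rewrite expr_le1//; lra.
  have xx : x ^+ 2 <= 1 by rewrite expr_le1//; lra.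
  have xy : x * y <= 1 by rewrite mulr_ile1//; lra.
  rewrite -[10]mul1r /f; apply: ler_pM => //; rewrite ?(ltW x0)//.
    by rewrite !addr_ge0 ?mulr_ge0 ?exprn_ge0 ?mulr_ge0//; lra.
  lra.
have /andP[f1 f2] := f10 A a A0 A1 a0 ltac:(lra).
have /andP[g1 g2] := f10 a A a0 ltac:(lra) A0 A1.
have D0 : 0 < f A a - f a A.
  have -> : f A a - f a A = (A - a) * (A ^+ 2 + a ^+ 2) by rewrite /f; ring.
  by rewrite mulr_gt0 ?subr_gt0// addr_gt0// exprn_gt0.
set D := f A a - f a A in D0.
have D10 : D <= 10 by rewrite /D; lra.
(* For this [e] the hypothesis yields [D <= 3 e * 10 + 7 e * 10 + e = 101 e], against
   [D = 200 e]. *)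
have [e0 e1] : 0 < D / 200 /\ D / 200 <= 1 by split; lra.
have := H _ e0 e1; rewrite !homf; set e := D / 200 in e0 e1 *.
have : 0 <= ((1 - e) ^+ 3 - (1 - 3 * e)) * f A a.
  apply: mulr_ge0 => //.
  have -> : (1 - e) ^+ 3 - (1 - 3 * e) = e ^+ 2 * (3 - e) by ring.
  by rewrite mulr_ge0 ?exprn_ge0//; lra.
have : 0 <= ((1 + 7 * e) - (1 + e) ^+ 3) * f a A.
  apply: mulr_ge0 => //.
  have -> : (1 + 7 * e) - (1 + e) ^+ 3 = e * ((1 - e) * (4 + e)) by ring.
  by rewrite !mulr_ge0//; lra.
have : 0 <= e * (10 - f A a) by rewrite mulr_ge0//; lra.
have : 0 <= e * (10 - f a A) by rewrite mulr_ge0//; lra.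
have De : D = 200 * e by rewrite /e; lra.
move: De; rewrite /D; lra.
Qed.

End freud_form.

(** Division by [C^3]: the leading form is homogeneous of degree 3, so the [tau] and [t] terms
    acquire factors [1 / C] and [1 / C^2]. *)
Lemma freud_form_scale (R : realFieldType) (tau t C v1 v2 v3 v4 v5 : R) :
  C != 0 ->
  C ^+ 3 = v3 * C * (6 * (v1 * C * (v2 * C) + (v2 * C) ^+ 2 +
    2 * (v2 * C) * (v3 * C) + (v3 * C) ^+ 2 + v2 * C * (v4 * C) +
    2 * (v3 * C) * (v4 * C) + (v4 * C) ^+ 2 + v4 * C * (v5 * C)) -
    4 * tau * (v2 * C + v3 * C + v4 * C) - 2 * t) ->
  6 * freud_form v1 v2 v3 v4 v5 =
    1 + v3 * (4 * tau / C * (v2 + v3 + v4) + 2 * t / C ^+ 2).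
Proof.
move=> C0 H; apply: (mulfI (expf_neq0 3 C0)).
set d1 := _ / C; set d2 := _ / C ^+ 2.
have E1 : 4 * tau = d1 * C by rewrite divfK.
have E2 : 2 * t = d2 * C ^+ 2 by rewrite divfK// expf_neq0.
by move: H; rewrite E1 E2 /freud_form; lra.
Qed.

Lemma cvg_freud_form (R : realType) (u1 u2 u3 u4 u5 : nat -> R)
    (a1 a2 a3 a4 a5 : R) :
  u1 @ \oo --> a1 -> u2 @ \oo --> a2 -> u3 @ \oo --> a3 ->
  u4 @ \oo --> a4 -> u5 @ \oo --> a5 ->
  freud_form (u1 n) (u2 n) (u3 n) (u4 n) (u5 n) @[n --> \oo]
    --> freud_form a1 a2 a3 a4 a5.
Proof.
move=> c1 c2 c3 c4 c5; rewrite /freud_form.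
have cM2 (u u' : nat -> R) (a a' : R) : u @ \oo --> a -> u' @ \oo --> a' ->
    2 * u n * u' n @[n --> \oo] --> 2 * a * a'.
  by move=> cu cu'; apply: cvgM => //; apply: cvgM => //; exact: cvg_cst.
apply: cvgM => //; apply: cvgD; last exact: cvgM.
apply: cvgD; last exact: cvgM.
apply: cvgD; last exact: cM2.
apply: cvgD; last exact: cvgM.
apply: cvgD; last exact: cvgM.
apply: cvgD; last exact: cM2.
by apply: cvgD; exact: cvgM.
Qed.

(** * Rescaling by the cube root of the index *)

Section cube_root_scale.
Context {R : realType} (c : nat -> R).
Hypothesis c_gt0 : forall n, 0 < c n.+1.
Hypothesis cX3 : forall n, c n ^+ 3 = n%:R.

Lemma scale_near_ge (M : R) : \forall n \near \oo, 0 < c n /\ M <= c n.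
Proof.
near=> n.
have n0 : (0 < n)%N by near: n; exact: nbhs_infty_gt.
have cn0 : 0 < c n by rewrite -(prednK n0).
split => //; rewrite leNgt; apply/negP => cM.
have : c n ^+ 3 < M ^+ 3 by rewrite ltrXn2r ?(ltW cn0)// ltW// (lt_trans cn0).
rewrite cX3 ltNge => /negP; apply.
by near: n; exact: nbhs_infty_ger.
Unshelve. all: by end_near. Qed.

Lemma scale_near_small (K e : R) : 0 < e ->
  \forall n \near \oo, [/\ 0 < c n, `|K / c n| <= e & `|K / c n ^+ 2| <= e].
Proof.
(* The summand [1] forces [c n >= 1], so the bound on [K / c n] carries over to [K / c n ^+ 2]. *)
move=> e0; apply: filterS (scale_near_ge (1 + `|K| / e)) => n [c0 cge].
have Ke : 0 <= `|K| / e by rewrite divr_ge0// ltW.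
have Kc : `|K| <= e * c n.
  by rewrite -ler_pdivrMl// mulrC; lra.
split => //.
  by rewrite normrM normfV (gtr0_norm c0) ler_pdivrMr.
rewrite normrM normfV (gtr0_norm (exprn_gt0 2 c0)) ler_pdivrMr ?exprn_gt0//.
apply: le_trans Kc _; rewrite expr2 mulrA ler_peMr ?mulr_ge0//; lra.
Qed.

(** For the ratio [r > 0], [|r - 1| <= |r^3 - 1|] because [r^2 + r + 1 >= 1], and
    [r^3 - 1 = (i - 2) / (n + 3)]. *)
Lemma scale_ratio (n i : nat) : (i <= 4)%N ->
  `|c (n + i.+1)%N / c n.+3 - 1| <= 2 / n.+3%:R.
Proof.
move=> i4; rewrite addnS; set r := c _ / _.
have r0 : 0 < r by rewrite divr_gt0.
have r3 : r ^+ 3 = (n + i).+1%:R / n.+3%:R by rewrite expr_div_n !cX3.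
have n3 : 0 < n.+3%:R :> R by rewrite ltr0n.
apply: (@le_trans _ _ (`|r ^+ 3 - 1|)).
  have -> : r ^+ 3 - 1 = (r - 1) * (r ^+ 2 + r + 1) by ring.
  rewrite normrM ler_peMr// ger0_norm; first by nra.
  by rewrite !addr_ge0 ?exprn_ge0// ltW.
have -> : r ^+ 3 - 1 = (i%:R - 2) / n.+3%:R.
  rewrite r3; apply: (mulIf (lt0r_neq0 n3)).
  by rewrite mulrBl !divfK ?lt0r_neq0// mul1r -!natr1 natrD; ring.
rewrite normrM normfV (gtr0_norm n3) ler_pM2r ?invr_gt0//.
have : i%:R <= 4 :> R by rewrite (ler_nat _ _ 4).
by have := ler0n R i; rewrite ler_norml => ? ?; apply/andP; split; lra.
Qed.

Section string.
Variables (tau t : R) (beta : nat -> R).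
Hypothesis beta_gt0 : forall n, 0 < beta n.
Hypothesis string : forall n,
  n.+3%:R = beta n.+3 * (6 * (beta n.+1 * beta n.+2 + beta n.+2 ^+ 2 +
    2 * beta n.+2 * beta n.+3 + beta n.+3 ^+ 2 + beta n.+2 * beta n.+4 +
    2 * beta n.+3 * beta n.+4 + beta n.+4 ^+ 2 + beta n.+4 * beta n.+4.+1) -
    4 * tau * (beta n.+2 + beta n.+3 + beta n.+4) - 2 * t).

Let z n := beta n / c n.
(* The window of five coefficients around index [n + 3], all on the scale of the
   central one, which is [v n 2]. *)
Let v n i := beta (n + i.+1)%N / c n.+3.
Let ff n := freud_form (v n 0) (v n 1) (v n 2) (v n 3) (v n 4).

Let v_gt0 n i : 0 < v n i.
Proof. by rewrite divr_gt0. Qed.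

Let vz n : v n 2 = z n.+3.
Proof. by rewrite /v /z addn3. Qed.

Let ffE n : 6 * ff n = 1 + v n 2 *
  (4 * tau / c n.+3 * (v n 1 + v n 2 + v n 3) + 2 * t / c n.+3 ^+ 2).
Proof.
have C0 : c n.+3 != 0 by rewrite gt_eqF.
have := string n; rewrite -cX3 /ff /v !addnS addn0.
rewrite -(divfK C0 (beta n.+1)) -(divfK C0 (beta n.+2)) -(divfK C0 (beta n.+3)).
rewrite -(divfK C0 (beta n.+4)) -(divfK C0 (beta n.+4.+1)) !(mulfK C0).
exact: freud_form_scale.
Qed.

Let drift_near (e : R) : 0 < e -> \forall n \near \oo,
  `|4 * tau / c n.+3| <= e /\ `|2 * t / c n.+3 ^+ 2| <= e.
Proof.
move=> e0; near=> n; rewrite -(addn3 n); split.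
  suff [] : [/\ 0 < c (n + 3)%N, `|4 * tau / c (n + 3)%N| <= e &
      `|4 * tau / c (n + 3)%N ^+ 2| <= e] by [].
  near: n; exact: (@near_infty_addn 3 _ (scale_near_small (4 * tau) e0)).
suff [] : [/\ 0 < c (n + 3)%N, `|2 * t / c (n + 3)%N| <= e &
    `|2 * t / c (n + 3)%N ^+ 2| <= e] by [].
near: n; exact: (@near_infty_addn 3 _ (scale_near_small (2 * t) e0)).
Unshelve. all: by end_near. Qed.

Let unshift3 (Q : nat -> Prop) :
  (\forall n \near \oo, Q n.+3) -> \forall n \near \oo, Q n.
Proof.
move=> [N _ QN]; exists N.+3 => // n /= Nn.
by case: n Nn => [|[|[|n]]]// Nn; exact: QN.
Qed.

(** By [ffE], [v n 2] times a bracket equals [1]. If [v n 2 > 1] and both drift coefficients are at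
    most [1/2], the squares in the bracket make it exceed [1], a contradiction. *)
Let z_gt0_le1 : \forall n \near \oo, 0 < z n <= 1.
Proof.
apply: unshift3; have e0 : 0 < 2^-1 :> R by lra.
apply: filterS (drift_near e0) => n [d1 d2]; rewrite -vz v_gt0 /= leNgt.
apply/negP => v1; have := ffE n.
have := v_gt0 n 0; have := v_gt0 n 1; have := v_gt0 n 3; have := v_gt0 n 4.
move: d1 d2 v1; rewrite /ff /freud_form !ler_norml.
move: (4 * tau / _) (2 * t / _) (v n 0) (v n 1) (v n 2) (v n 3) (v n 4).
move=> d1 d2 x1 x2 x3 x4 x5 /andP[d1l d1u] /andP[d2l d2u] x3g p5 p4 p2 p1.
set Q := (X in 6 * (x3 * X)) => E.
have QE : x2 ^+ 2 + x3 ^+ 2 + x4 ^+ 2 <= Q.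
  have := mulr_gt0 p1 p2; have := mulr_gt0 p4 p5; have := mulr_gt0 p2 p4.
  have x3p : 0 < x3 by lra.
  have := mulr_gt0 p2 x3p; have := mulr_gt0 x3p p4.
  by rewrite /Q; lra.
have x3p : 0 < x3 by lra.
have : 0 <= (2^-1 - d1) * (x2 + x3 + x4) by rewrite mulr_ge0; lra.
have S4 : 0 <= (x4 - 2^-1) ^+ 2 by exact: sqr_ge0.
have S2 : 0 <= (x2 - 2^-1) ^+ 2 by exact: sqr_ge0.
have S3 : 0 <= (x3 - 1) * x3 by rewrite mulr_ge0; lra.
move=> S1.
have : 1 < 6 * Q - (d1 * (x2 + x3 + x4) + d2) by lra.
move=> G; have : 0 < (x3 - 1) * (6 * Q - (d1 * (x2 + x3 + x4) + d2)).
  by rewrite mulr_gt0; lra.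
lra.
Qed.

Let v_near (e : R) (i : nat) : (i <= 4)%N -> 0 < e ->
  \forall n \near \oo, `|v n i - z (n + i.+1)%N| <= e.
Proof.
move=> i4 e0; near=> n.
have /andP[z0 z1] : 0 < z (n + i.+1)%N <= 1.
  by near: n; exact: (@near_infty_addn i.+1 _ z_gt0_le1).
have ne : 2 / e <= n%:R by near: n; exact: nbhs_infty_ger.
have cn : c (n + i.+1)%N != 0 by rewrite addnS gt_eqF.
have -> : v n i - z (n + i.+1)%N =
    z (n + i.+1)%N * (c (n + i.+1)%N / c n.+3 - 1).
  by rewrite mulrBr mulr1 mulrA divfK.
rewrite normrM (gtr0_norm z0); apply: (@le_trans _ _ (1 * (2 / n.+3%:R))).
  by apply: ler_pM => //; [exact: ltW|exact: scale_ratio].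
rewrite mul1r ler_pdivrMr ?ltr0n// mulrC -ler_pdivrMr//.
by apply: le_trans ne _; rewrite ler_nat -addn3 leq_addr.
Unshelve. all: by end_near. Qed.

Let v_le2 : \forall n \near \oo, forall i, (i <= 4)%N -> v n i <= 2.
Proof.
have H i : (i <= 4)%N -> \forall n \near \oo, v n i <= 2.
  move=> i4; near=> n.
  have /andP[z0 z1] : 0 < z (n + i.+1)%N <= 1.
    by near: n; exact: (@near_infty_addn i.+1 _ z_gt0_le1).
  have : `|v n i - z (n + i.+1)%N| <= 1 by near: n; exact: v_near.
  by rewrite ler_norml => /andP[]; lra.
near=> n => -[|[|[|[|[|//]]]]] _; near: n; exact: H.
Unshelve. all: by end_near. Qed.

Let ff_near (e : R) : 0 < e -> \forall n \near \oo, `|ff n - 6^-1| <= e.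
Proof.
(* With entries at most [2] the error is at most [2 * (6 + 1) * (e / 3) / 6 = 7 e / 9]. *)
move=> e0; have e30 : 0 < e / 3 by lra.
near=> n.
have [d1 d2] : `|4 * tau / c n.+3| <= e / 3 /\ `|2 * t / c n.+3 ^+ 2| <= e / 3.
  by near: n; exact: drift_near.
have v2 : forall i, (i <= 4)%N -> v n i <= 2 by near: n; exact: v_le2.
have -> : ff n - 6^-1 = 6^-1 * (v n 2 *
  (4 * tau / c n.+3 * (v n 1 + v n 2 + v n 3) + 2 * t / c n.+3 ^+ 2)).
  by have := ffE n; lra.
rewrite normrM normrM (gtr0_norm (v_gt0 n 2)) ger0_norm ?invr_ge0//.
have s0 : 0 < v n 1 + v n 2 + v n 3 by rewrite !addr_gt0.
have s6 : v n 1 + v n 2 + v n 3 <= 6.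
  by have := v2 1%N isT; have := v2 2%N isT; have := v2 3%N isT; lra.
have : `|4 * tau / c n.+3 * (v n 1 + v n 2 + v n 3) + 2 * t / c n.+3 ^+ 2|
    <= e / 3 * 6 + e / 3.
  apply: le_trans (ler_normD _ _) _; apply: lerD => //.
  by rewrite normrM (gtr0_norm s0) ler_pM// ltW.
move=> B; have : v n 2 * `|4 * tau / c n.+3 * (v n 1 + v n 2 + v n 3) +
    2 * t / c n.+3 ^+ 2| <= 2 * (e / 3 * 6 + e / 3).
  by apply: ler_pM => //; [exact: ltW|exact: v2].
lra.
Unshelve. all: by end_near. Qed.

(** A central entry below [1/1000] with neighbours at most [2] makes [ff n] about [0.02] at most,
    yet it tends to [1/6]. This keeps the liminf positive. *)
Let z_lower : \forall n \near \oo, 1000^-1 <= z n.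
Proof.
apply: unshift3; near=> n; rewrite -vz leNgt; apply/negP => vl.
have v2 : forall i, (i <= 4)%N -> v n i <= 2 by near: n; exact: v_le2.
have : `|ff n - 6^-1| <= 12^-1.
  by near: n; apply: ff_near; lra.
have : ff n <= freud_form 2 2 1000^-1 2 2.
  by apply: le_freud_form; rewrite (ltW (v_gt0 _ _)) ?v2 ?(ltW vl).
rewrite /freud_form ler_norml => H /andP[]; lra.
Unshelve. all: by end_near. Qed.

Lemma string_limit : exists A : R, [/\ 0 < A, 60 * A ^+ 3 = 1 &
  beta n / c n @[n --> \oo] --> A].
Proof.
have z01 : \forall n \near \oo, 0 <= z n <= 1.
  by apply: filterS z_gt0_le1 => n /andP[/ltW -> ->].
have zm1 : \forall n \near \oo, 1000^-1 <= z n <= 1.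
  by near=> n; apply/andP; split; near: n;
    [exact: z_lower|apply: filterS z01 => n /andP[]].
have [A [A1 Ale Age]] := bounded_limsup z01.
have [a [am ale age]] := bounded_liminf zm1.
have a0 : 0 < a by lra.
have aA : a <= A.
  rewrite leNgt; apply/negP => Aa.
  have e0 : 0 < (a - A) / 3 by lra.
  have : \forall n \near \oo, z n <= A + (a - A) / 3 /\ a - (a - A) / 3 <= z n.
    by near=> n; split; near: n; [exact: Ale|exact: ale].
  by move=> [N _ /(_ N (leqnn _))] []; lra.
have A0 : 0 < A by lra.
have v_bounds e : 0 < e -> \forall n \near \oo,
    `|ff n - 6^-1| <= e / 2 /\
    forall i, (i <= 4)%N -> (1 - e) * a <= v n i <= (1 + e) * A.
  (* Two errors of [e * a / 2], from the liminf or limsup and from [v_near], add up to a relative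
     error [e], as [a <= A]. *)
  move=> e0; have ea : 0 < e * a / 2 by rewrite divr_gt0 ?mulr_gt0.
  have eA : e * a / 2 <= e * A / 2 by rewrite ler_pM2r ?ler_pM2l.
  have H i : (i <= 4)%N ->
      \forall n \near \oo, (1 - e) * a <= v n i <= (1 + e) * A.
    move=> i4; near=> n.
    have : `|v n i - z (n + i.+1)%N| <= e * a / 2 by near: n; exact: v_near.
    have : z (n + i.+1)%N <= A + e * a / 2.
      by near: n; exact: (@near_infty_addn i.+1 _ (Ale _ ea)).
    have : a - e * a / 2 <= z (n + i.+1)%N.
      by near: n; exact: (@near_infty_addn i.+1 _ (ale _ ea)).
    rewrite ler_norml => ? ? /andP[? ?]; apply/andP; split; lra.
  near=> n; split; first by near: n; apply: ff_near; lra.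
  by case=> [|[|[|[|[|//]]]]] _; near: n; exact: H.
(* An index beyond [N + 3] has the form [m.+3], so it is the centre of a window to which [v_bounds]
   applies. *)
have frequently e : 0 < e -> exists n,
    [/\ `|ff n - 6^-1| <= e / 2,
      forall i, (i <= 4)%N -> (1 - e) * a <= v n i <= (1 + e) * A &
      (1 - e) * A <= v n 2].
  move=> e0; have [N _ HN] := v_bounds e e0.
  have [m Nm zm] := Age (e * A) (mulr_gt0 e0 A0) N.+3.
  case: m Nm zm => [|[|[|m]]]// Nm zm; have [? ?] := HN m Nm.
  by exists m; split => //; rewrite vz; lra.
have frequently' e : 0 < e -> exists n,
    [/\ `|ff n - 6^-1| <= e / 2,
      forall i, (i <= 4)%N -> (1 - e) * a <= v n i <= (1 + e) * A &
      v n 2 <= (1 + e) * a].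
  move=> e0; have [N _ HN] := v_bounds e e0.
  have [m Nm zm] := age (e * a) (mulr_gt0 e0 a0) N.+3.
  case: m Nm zm => [|[|[|m]]]// Nm zm; have [? ?] := HN m Nm.
  by exists m; split => //; rewrite vz; lra.
(* Near [A] the central entry is large and its neighbours are at least about [a]; near [a] the roles
   are reversed. The two deviations [e / 2] from [1/6] make up the added [e]. *)
have Aa : A = a.
  apply: freud_form_extremal_eq => // e e0 e1.
  have [n [fn vn vnA]] := frequently e e0.
  have [m [fm vm vma]] := frequently' e e0.
  have ea0 : 0 <= (1 - e) * a by rewrite mulr_ge0 ?subr_ge0// ltW.
  have eA0 : 0 <= (1 - e) * A by rewrite mulr_ge0 ?subr_ge0// ltW.
  have L : freud_form ((1 - e) * a) ((1 - e) * a) ((1 - e) * A) ((1 - e) * a)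
      ((1 - e) * a) <= ff n.
    by apply: le_freud_form; rewrite ?ea0 ?eA0 ?vnA//;
      [case/andP: (vn 0%N isT)|case/andP: (vn 1%N isT)|
       case/andP: (vn 3%N isT)|case/andP: (vn 4%N isT)].
  have U : ff m <= freud_form ((1 + e) * A) ((1 + e) * A) ((1 + e) * a)
      ((1 + e) * A) ((1 + e) * A).
    by apply: le_freud_form; rewrite ?(ltW (v_gt0 _ _)) ?vma//;
      [case/andP: (vm 0%N isT)|case/andP: (vm 1%N isT)|
       case/andP: (vm 3%N isT)|case/andP: (vm 4%N isT)].
  by move: fn fm; rewrite !ler_norml => /andP[? ?] /andP[? ?]; lra.
have zA : z n @[n --> \oo] --> A.
  apply/cvgrPdist_le => e e0; near=> n.
  have : z n <= A + e by near: n; exact: Ale.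
  have : a - e <= z n by near: n; exact: ale.
  by rewrite -Aa ler_norml => ? ?; apply/andP; split; lra.
exists A; split => //.
have vA i : (i <= 4)%N -> v n i @[n --> \oo] --> A.
  move=> i4; apply/cvgrPdist_le => e e0; have e20 : 0 < e / 2 by lra.
  near=> n.
  have : `|v n i - z (n + i.+1)%N| <= e / 2 by near: n; exact: v_near.
  have : z (n + i.+1)%N <= A + e / 2.
    by near: n; exact: (@near_infty_addn i.+1 _ (Ale _ e20)).
  have : a - e / 2 <= z (n + i.+1)%N.
    by near: n; exact: (@near_infty_addn i.+1 _ (ale _ e20)).
  by rewrite -Aa !ler_norml => ? ? /andP[? ?]; apply/andP; split; lra.
(* All five entries tend to [A], so [10 A^3 = 1/6]. *)
have ffA : ff n @[n --> \oo] --> freud_form A A A A A.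
  by apply: cvg_freud_form; exact: vA.
have ff6 : ff n @[n --> \oo] --> (6^-1 : R).
  apply/cvgrPdist_le => e e0; apply: filterS (ff_near e0) => n.
  by rewrite distrC.
have : freud_form A A A A A = 6^-1 by exact: (cvg_unique _ ffA ff6).
by rewrite /freud_form; lra.
Unshelve. all: by end_near. Qed.

End string.
End cube_root_scale.

(** * The cubic *)

Section cubic.
Context {R : realType} (tau t : R).
Let M : R := 1 + `|tau| + `|t|.

Let M_ge1 : 1 <= M.
Proof. by rewrite /M -addrA lerDl addr_ge0. Qed.

Let tauM : - M <= tau <= M.
Proof. by rewrite -ler_norml /M; have := normr_ge0 t; lra. Qed.

Let tM : - M <= t <= M.
Proof. by rewrite -ler_norml /M; have := normr_ge0 tau; lra. Qed.

(** The expression is the divided difference of the cubic at [x] and [y], so the cubic is injective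
    on [[M, +oo)]. *)
Let slope_ge1 (x y : R) : M <= x -> M <= y ->
  1 <= 60 * (x ^+ 2 + x * y + y ^+ 2) - 12 * tau * (x + y) - 2 * t.
Proof.
move=> Mx My; have /andP[_ tau1] := tauM; have /andP[_ t1] := tM.
have := M_ge1 => M1.
have : 0 <= (M - tau) * (x + y) by rewrite mulr_ge0; lra.
have : 0 <= (x - M) * x by rewrite mulr_ge0; lra.
have : 0 <= (y - M) * y by rewrite mulr_ge0; lra.
have : 0 <= (x - M) * (y - 1) by rewrite mulr_ge0; lra.
have : 0 <= (y - M) * (x - 1) by rewrite mulr_ge0; lra.
have : 0 <= (x - 1) * (y - 1) by rewrite mulr_ge0; lra.
have : 0 <= (x - M) * (y - M) by rewrite mulr_ge0; lra.
have : 0 <= (M - 1) * M by rewrite mulr_ge0; lra.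
have : 0 <= (x - M) * M by rewrite mulr_ge0; lra.
have : 0 <= (y - M) * M by rewrite mulr_ge0; lra.
lra.
Qed.

(** The cubic is nonpositive for [b <= - M], and on [[-M, M]] it is at most [(60 + 12 + 2) M^3]. *)
Let cubic_large_root (b n : R) : 74 * M ^+ 3 < n -> cubic tau t b = n -> M < b.
Proof.
move=> Mn bn; rewrite ltNge; apply/negP => bM.
have M1 := M_ge1; have /andP[tau0 tau1] := tauM; have /andP[t0 t1] := tM.
suff : cubic tau t b <= 74 * M ^+ 3 by rewrite bn; lra.
have M3 : 0 < M ^+ 3 by rewrite exprn_gt0//; lra.
rewrite /cubic; have [bM'|bM'] := leP b (- M).
  have -> : 60 * b ^+ 3 - 12 * tau * b ^+ 2 - 2 * t * b =
    b * (60 * b ^+ 2 - 12 * tau * b - 2 * t) by ring.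
  apply: (@le_trans _ _ 0); last by lra.
  rewrite mulr_le0_ge0//; first by lra.
  have : 0 <= (M + tau) * - b by rewrite mulr_ge0; lra.
  have : 0 <= (- b - M) * - b by rewrite mulr_ge0; lra.
  have : 0 <= (- b - M) * M by rewrite mulr_ge0; lra.
  have : 0 <= (M - 1) * M by rewrite mulr_ge0; lra.
  lra.
have nb : `|b| <= M by rewrite ler_norml; lra.
have ntau : `|tau| <= M by rewrite ler_norml tauM.
have nt : `|t| <= M by rewrite ler_norml tM.
have b2 : `|b| ^+ 2 <= M ^+ 2 by rewrite lerXn2r ?nnegrE//; lra.
have b3 : `|b| ^+ 3 <= M ^+ 3 by rewrite lerXn2r ?nnegrE//; lra.
have tb2 : `|tau| * `|b| ^+ 2 <= M * M ^+ 2 by rewrite ler_pM ?exprn_ge0.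
have tb : `|t| * `|b| <= M * M by rewrite ler_pM.
have : b ^+ 3 <= `|b| ^+ 3 by rewrite -normrX ler_norm.
have : - (tau * b ^+ 2) <= `|tau| * `|b| ^+ 2.
  by rewrite -normrX -normrM -normrN ler_norm.
have : - (t * b) <= `|t| * `|b| by rewrite -normrM -normrN ler_norm.
have : 0 <= (M - 1) * (M * M) by rewrite !mulr_ge0; lra.
lra.
Qed.

Lemma cubic_unique_root (n : R) : 74 * M ^+ 3 < n ->
  exists b : R, (cubic tau t b = n /\ 0 < b) /\
    (forall b', cubic tau t b' = n -> b' = b).
Proof.
move=> Mn; have M1 := M_ge1; have M3 : 0 < M ^+ 3 by rewrite exprn_gt0//; lra.
pose p : {poly R} := 60 *: 'X^3 - (12 * tau) *: 'X^2 - (2 * t) *: 'X - n%:P.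
have pE x : p.[x] = cubic tau t x - n by rewrite /p /cubic !hornerE.
(* The value at [M + n] is at least [n]: it exceeds the nonnegative value at [M] by [n] times a
   slope at least [1]. *)
have [||b _ /rootP] := @poly_ivt _ p 0 (M + n).
- by lra.
- rewrite !pE; apply/andP; split; first by rewrite /cubic; lra.
  have Mn' : M <= M + n by lra.
  have : 0 <= n * (60 * ((M + n) ^+ 2 + (M + n) * M + M ^+ 2) -
      12 * tau * (M + n + M) - 2 * t - 1).
    by rewrite mulr_ge0 ?subr_ge0 ?(slope_ge1 Mn' (lexx M))//; lra.
  have /andP[_ tau1] := tauM; have /andP[_ t1] := tM.
  have : 0 <= (M - tau) * M ^+ 2 by rewrite mulr_ge0 ?exprn_ge0; lra.
  have : 0 <= (M - t) * M by rewrite mulr_ge0; lra.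
  have : 0 <= (M - 1) * M ^+ 2 by rewrite mulr_ge0 ?exprn_ge0; lra.
  by rewrite /cubic; lra.
rewrite pE => /eqP; rewrite subr_eq0 => /eqP bn.
have Mb := cubic_large_root Mn bn.
exists b; split; first by split => //; lra.
move=> b' b'n; have Mb' := cubic_large_root Mn b'n.
have := slope_ge1 (ltW Mb') (ltW Mb) => S; apply/eqP.
have /eqP : (b' - b) * (60 * (b' ^+ 2 + b' * b + b ^+ 2) - 12 * tau * (b' + b)
  - 2 * t) = 0 by move: bn b'n; rewrite /cubic; lra.
by rewrite mulf_eq0 subr_eq0 (gt_eqF (lt_le_trans ltr01 S)) orbF.
Qed.

(** For [y = bb n / c n] the cubic reads [60 y^3 = 1 + o(1) (y^2 + y)], which bounds [y]. Then [60
    y^3 - 1 = 60 (y - A) (y^2 + y A + A^2)], whose last factor is at least [3 A^2 / 4]. *)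
Lemma cubic_root_limit (c bb : nat -> R) (A : R) :
  (forall n, 0 < c n.+1) -> (forall n, c n ^+ 3 = n%:R) ->
  0 < A -> 60 * A ^+ 3 = 1 ->
  (\forall n \near \oo, cubic tau t (bb n) = n%:R) ->
  bb n / c n @[n --> \oo] --> A.
Proof.
move=> c_gt0 cX3 A0 A3 bbn; apply/cvgrPdist_le => e e0.
pose d := Num.min 1 (e * A ^+ 2).
have d0 : 0 < d by rewrite lt_min ltr01 mulr_gt0 ?exprn_gt0.
have [d1 de] : d <= 1 /\ d <= e * A ^+ 2 by split; rewrite /d ge_min lexx ?orbT.
near=> n.
have [cn0 dt _] : [/\ 0 < c n,
    `|12 * tau / c n| <= d & `|12 * tau / c n ^+ 2| <= d].
  by near: n; exact: (scale_near_small c_gt0 cX3).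
have [_ _ dt'] : [/\ 0 < c n, `|2 * t / c n| <= d & `|2 * t / c n ^+ 2| <= d].
  by near: n; exact: (scale_near_small c_gt0 cX3).
have : cubic tau t (bb n) = n%:R by near: n.
rewrite -cX3 -[bb n](divfK (lt0r_neq0 cn0)) mulfK ?lt0r_neq0//.
move: (c n) (bb n / c n) cn0 dt dt' => C y C0.
set d2 := _ / C; set d3 := _ / C ^+ 2 => D2 D3 H.
have E2 : 12 * tau = d2 * C by rewrite divfK ?lt0r_neq0.
have E3 : 2 * t = d3 * C ^+ 2 by rewrite divfK// ?lt0r_neq0// exprn_gt0.
have {}H : 60 * y ^+ 3 = 1 + d2 * y ^+ 2 + d3 * y.
  apply: (mulfI (expf_neq0 3 (lt0r_neq0 C0))).
  by move: H; rewrite /cubic E2 E3; lra.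
have yd : `|60 * y ^+ 3 - 1| <= d * `|y| ^+ 2 + d * `|y|.
  have -> : 60 * y ^+ 3 - 1 = d2 * y ^+ 2 + d3 * y by lra.
  apply: le_trans (ler_normD _ _) _.
  by rewrite (normrM d2) (normrM d3) normrX lerD// ler_wpM2r ?exprn_ge0.
(* Otherwise [60 |y|^3 <= 1 + |y|^2 + |y|], impossible for [|y| > 1]. *)
have y1 : `|y| <= 1.
  rewrite leNgt; apply/negP => y1.
  have : 60 * `|y| ^+ 3 <= 1 + (d * `|y| ^+ 2 + d * `|y|).
    have -> : 60 * `|y| ^+ 3 = `|60 * y ^+ 3|
      by rewrite normrM normrX ger0_norm.
    rewrite -[60 * y ^+ 3](subrK 1) addrC.
    by apply: le_trans (ler_normD _ _) _; rewrite normr1 lerD2l.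
  have : 0 <= (1 - d) * `|y| ^+ 2 by rewrite mulr_ge0 ?exprn_ge0; lra.
  have : 0 <= (1 - d) * `|y| by rewrite mulr_ge0; lra.
  have : 0 <= (`|y| - 1) * `|y| by rewrite mulr_ge0; lra.
  have : 0 <= (`|y| - 1) * `|y| ^+ 2 by rewrite mulr_ge0 ?exprn_ge0; lra.
  lra.
have yd2 : `|60 * y ^+ 3 - 1| <= 2 * d.
  have : `|y| ^+ 2 <= 1 by rewrite exprn_ile1.
  move=> y2; have : 0 <= d * (1 - `|y| ^+ 2) by rewrite mulr_ge0; lra.
  have : 0 <= d * (1 - `|y|) by rewrite mulr_ge0; lra.
  by lra.
have : 60 * y ^+ 3 - 1 = 60 * (y - A) * (y ^+ 2 + y * A + A ^+ 2) by lra.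
move=> F; move: yd2; rewrite F !normrM distrC ger0_norm// => G.
have q : 3 / 4 * A ^+ 2 <= `|y ^+ 2 + y * A + A ^+ 2|.
  apply: le_trans (ler_norm _); have := sqr_ge0 (y + A / 2); lra.
have : `|A - y| * (3 / 4 * A ^+ 2) <= `|A - y| * `|y ^+ 2 + y * A + A ^+ 2|.
  by rewrite ler_wpM2l.
have A20 : 0 < A ^+ 2 by rewrite exprn_gt0.
move=> G'; rewrite -(ler_pM2r A20).
have : 0 <= `|A - y| * A ^+ 2 by rewrite mulr_ge0// ltW.
lra.
Unshelve. all: by end_near. Qed.

End cubic.

(** * Application to the weight and conclusion *)

Lemma monic_OPS_string (R : realType) (tau t : R) (P : nat -> {poly R})
    (h : nat -> R) : monic_OPS tau t P h -> forall n,
  let b := rec_coef h in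
  n.+3%:R = b n.+3 * (6 * (b n.+1 * b n.+2 + b n.+2 ^+ 2 +
    2 * b n.+2 * b n.+3 + b n.+3 ^+ 2 + b n.+2 * b n.+4 +
    2 * b n.+3 * b n.+4 + b n.+4 ^+ 2 + b n.+4 * b n.+4.+1) -
    4 * tau * (b n.+2 + b n.+3 + b n.+4) - 2 * t).
Proof.
move=> [P_monic_size [P_int [P_orth h_gt0]]] n.
have P_monic k : P k \is monic by case: (P_monic_size k).
have P_size k : size (P k) = k.+1 by case: (P_monic_size k).
have P0 : P 0%N = 1.
  rewrite [P 0%N]size1_polyC ?P_size//.
  by have /monicP := P_monic 0%N; rewrite lead_coefE P_size => ->.
(* Since [P 0 = 1], the products [P 0 * P i] make each [P i] integrable against the weight, and the
   [P i] span. *)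
have wi (p : {poly R}) :
    (@lebesgue_measure R).-integrable setT
      (fun x => (p.[x] * weight tau t x)%:E).
  apply: (@monic_basis_ind _ P P_monic P_size (size p)
    (fun p => (@lebesgue_measure R).-integrable setT
      (fun x => (p.[x] * weight tau t x)%:E))) => //.
    by under eq_fun do rewrite horner0 mul0r; exact: integrable0.
  move=> a i q _ qi.
  under eq_fun do rewrite hornerD hornerZ mulrDl EFinD -mulrA EFinM.
  apply: integrableD => //; apply: integrableZl => //.
  by have := P_int 0%N i; under eq_fun do rewrite P0 hornerC mul1r.
pose L (p : {poly R}) :=
  (\int[@lebesgue_measure R]_x (p.[x] * weight tau t x))%R.
apply: (@string_equation R P P_monic P_size L h) => //.
- move=> p q; rewrite /L -RintegralD//; [|exact: wi..].
  by apply: eq_Rintegral => x _; rewrite hornerD mulrDl.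
- move=> a p; rewrite /L -RintegralZl//; last exact: wi.
  by apply: eq_Rintegral => x _; rewrite hornerZ mulrA.
- move=> i j; rewrite /L /Rintegral.
  by under eq_integral do rewrite hornerM; rewrite P_orth; case: ifP.
- by move=> p; exact: integral_poly_weight_even.
- by move=> p; exact: integral_poly_weight_deriv.
Qed.

Theorem theorem3p4 (R : realType) (tau t : R) (P : nat -> {poly R}) (h : nat -> R) :
  monic_OPS tau t P h ->
  (exists N : nat, forall n : nat, (N <= n)%N ->
     exists b : R, (cubic tau t b = n%:R /\ 0 < b) /\
       (forall b' : R, cubic tau t b' = n%:R -> b' = b)) /\
  (forall bb : nat -> R,
     (\forall n \near \oo, cubic tau t (bb n) = n%:R) ->
     (fun n => rec_coef h n / bb n) @ \oo --> (1 : R)).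
Proof.
move=> Ph; split.
  have [N _ HN] := @nbhs_infty_gtr R (74 * (1 + `|tau| + `|t|) ^+ 3).
  by exists N => n Nn; apply: cubic_unique_root; exact: HN.
move=> bb bbn; have h_gt0 : forall n, 0 < h n by case: Ph => _ [_ []].
pose c (n : nat) : R := n%:R `^ 3^-1.
have c_gt0 n : 0 < c n.+1 by rewrite powR_gt0.
have cX3 n : c n ^+ 3 = n%:R.
  by rewrite -powR_mulrn ?powR_ge0// -powRrM mulVf// powRr1.
have beta_gt0 n : 0 < rec_coef h n by rewrite divr_gt0.
have [A [A0 A3 bA]] := string_limit c_gt0 cX3 beta_gt0 (monic_OPS_string Ph).
have yA := cubic_root_limit c_gt0 cX3 A0 A3 bbn.
have AN0 : A != 0 by rewrite gt_eqF.
(* Both sequences divided by [c n] tend to the same [A], and [c n] cancels in the quotient. *)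
have : rec_coef h n / c n * (bb n / c n)^-1 @[n --> \oo] --> A / A.
  by apply: cvgM => //; exact: cvgV.
rewrite divff//; apply: cvg_trans; apply: near_eq_cvg; near=> n => /=.
have cn : c n != 0.
  have n0 : (0 < n)%N by near: n; exact: nbhs_infty_gt.
  by rewrite -(prednK n0) gt_eqF.
by rewrite invf_div mulrA divfK.
Unshelve. all: by end_near. Qed.
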